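(* Let $a\in\mathbb{C}$ be a root of $x^2+x+2$, and let $\mathcal{K}'$ be the arrangement of the following $12$ lines in $\mathbb{P}^2_{\mathbb{C}}$ with homogeneous coordinates $(x:y:z)$: $$ax+y-z=0,\quad ax-y+z=0,\quad ax-y-z=0,\quad ax+y+z=0,$$ $$x+ay-z=0,\quad -x+ay+z=0,\quad -x+ay-z=0,\quad x+ay+z=0,$$ $$-x+y+az=0,\quad -x-y+az=0,\quad x-y+az=0,\quad x+y+az=0.$$ Then the intersection points of the lines in $\mathcal{K}'$ are exactly $12$ triple points and $30$ double points. Moreover, on each line of $\mathcal{K}'$ there are exactly $3$ triple intersection points. In other words, the $12$ lines of $\mathcal{K}'$ and their $12$ triple points form a complex $(12_3)$ point-line configuration.
   Context: For an arrangement of finitely many distinct lines in the projective plane, an intersection point is a point lying on at least two of the lines. A double (respectively triple) point is a point lying on exactly two (respectively exactly three) lines of the arrangement. An $(n_k)$ point-line configuration consists of $n$ points and $n$ lines such that each of the lines contains exactly $k$ of the points and each of the points lies on exactly $k$ of the lines. *)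

(* Defs.v *)
From mathcomp Require Import all_boot all_order all_algebra.
From mathcomp Require Import boolp classical_sets cardinality reals.
From mathcomp Require Import complex.

Set Implicit Arguments.
Unset Strict Implicit.
Unset Printing Implicit Defensive.

Import GRing.Theory.

Local Open Scope classical_set_scope.
Local Open Scope card_scope.
Local Open Scope ring_scope.

(* Points of P^2(K) are the one-dimensional subspaces of K^3; the nonzero
   vectors (x, y, z) of such a subspace are the homogeneous coordinates of the
   point. Lines are identified with their sets of points. *)
Definition proj_plane (K : fieldType) : Type :=
  {U : {vspace 'rV[K]_3} | \dim U == 1%N}.

Definition line_eqn (K : fieldType) (p q r : K) : set (proj_plane K) :=
  [set P : proj_plane K | forall v : 'rV[K]_3,
     v \in sval P -> p * v 0 0 + q * v 0 1 + r * v 0 2 = 0].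

Definition is_line (K : fieldType) (L : set (proj_plane K)) : Prop :=
  exists p q r : K, (p, q, r) <> (0, 0, 0) /\ L = line_eqn p q r.

Section Arrangement.
Variables (K : fieldType) (A : set (set (proj_plane K))).

Definition lines_through (P : proj_plane K) : set (set (proj_plane K)) :=
  [set L | A L /\ L P].

Definition intersection_points : set (proj_plane K) :=
  [set P | exists L M, [/\ lines_through P L, lines_through P M & L <> M]].

Definition points_of_mult (m : nat) : set (proj_plane K) :=
  [set P | lines_through P #= `I_m].

Definition double_points := points_of_mult 2.
Definition triple_points := points_of_mult 3.

End Arrangement.

Definition is_configuration (K : fieldType) (n k : nat)
    (S : set (proj_plane K)) (A : set (set (proj_plane K))) : Prop :=
  [/\ S #= `I_n,
      A #= `I_n,
      forall L, A L -> is_line L,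
      forall L, A L -> (L `&` S) #= `I_k &
      forall P, S P -> lines_through A P #= `I_k].

Definition Kprime (K : fieldType) (a : K) : set (set (proj_plane K)) :=
  [set line_eqn    a    1  (-1);
       line_eqn    a  (-1)   1;
       line_eqn    a  (-1) (-1);
       line_eqn    a    1    1;
       line_eqn    1    a  (-1);
       line_eqn  (-1)   a    1;
       line_eqn  (-1)   a  (-1);
       line_eqn    1    a    1;
       line_eqn  (-1)   1    a;
       line_eqn  (-1) (-1)   a;
       line_eqn    1  (-1)   a;
       line_eqn    1    1    a].

(* Main.v *)
Require Import Defs.
From mathcomp Require Import all_boot all_order all_algebra.
From mathcomp Require Import boolp classical_sets cardinality reals.
From mathcomp Require Import complex.
From mathcomp Require Import ring lra.

Set Implicit Arguments.
Unset Strict Implicit.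
Unset Printing Implicit Defensive.

Local Open Scope classical_set_scope.
Local Open Scope card_scope.
Local Open Scope ring_scope.

Import Order.TTheory GRing.Theory Num.Theory.

(** Write the lines as vectors l_0, ..., l_11 of Z[a]^3. Two lines l_i and l_j
   meet exactly in the point spanned by the cross product l_i x l_j, and l_k
   passes through that point iff l_k . (l_i x l_j) = 0. Since u + v a has norm
   u^2 - u v + 2 v^2 for integers u and v, it vanishes only if u = v = 0, so
   that all these incidences are decidable by integer arithmetic on pairs
   (u, v). An intersection point is determined by the set of indices of the
   lines through it, so counting points amounts to counting such index sets. *)

(** * Cardinality of a set from a duplicate-free enumeration *)

Lemma card_eq_size (T : Type) (U : eqType) (A : set T) (f : T -> U) (s : seq U) :
  uniq s -> {in A &, injective f} -> f @` A = [set` s] -> A #= `I_(size s).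
Proof.
move=> us finj fA; apply: (card_eq_trans (card_esym (inj_card_eq finj))).
(* [nth] needs a default element. In the nonempty case the head [x] serves, and [nth x] is a
   bijection from [I_(size s)] onto the list. *)
rewrite {}fA; case: s us => [|x s] us.
  by rewrite (_ : [set` [::]] = set0) ?II0 //; apply/seteqP; split.
have nth_inj : {in `I_(size (x :: s)) &, injective (nth x (x :: s))}.
  by move=> i j; rewrite !inE => ilt jlt /eqP; rewrite nth_uniq // => /eqP.
rewrite (_ : [set` _] = nth x (x :: s) @` `I_(size (x :: s))).
  exact: inj_card_eq nth_inj.
apply/seteqP; split=> [y /= /(nthP x) [i ilt <-]|y [i ilt <-]]; first by exists i.
exact: mem_nth.
Qed.

(** * Combinatorics of finitely many lines with decidable concurrency *)

Section Incidence.

Variables (K : fieldType) (n : nat) (L : nat -> set (proj_plane K)).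
Variable conc : nat -> nat -> nat -> bool.

Hypothesis meet_ex : forall i j, (i < n)%N -> (j < n)%N -> i != j ->
  exists P, L i P /\ L j P.
Hypothesis meet_uniq : forall i j P Q, (i < n)%N -> (j < n)%N -> i != j ->
  L i P -> L j P -> L i Q -> L j Q -> P = Q.
Hypothesis concP : forall i j k P,
  (i < n)%N -> (j < n)%N -> (k < n)%N -> i != j -> L i P -> L j P ->
  L k P <-> conc i j k.
Hypothesis separated : forall i j, (i < n)%N -> (j < n)%N -> i != j ->
  exists2 k, (k < n)%N & (i != k) && ~~ conc i k j.

Let A := L @` `I_n.

Definition indices (P : proj_plane K) : seq nat :=
  [seq k <- iota 0 n | `[<L k P>]].

Definition flat (i j : nat) : seq nat := [seq k <- iota 0 n | conc i j k].

(** The unordered pairs of distinct lines are listed as [j < i]. A point on m of the lines arises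
    from m(m-1)/2 such pairs, and [undup] keeps one copy. *)
Definition flats : seq (seq nat) :=
  undup [seq flat i j | i <- iota 0 n, j <- iota 0 i].

Lemma mem_indices P k : (k \in indices P) = (k < n)%N && `[<L k P>].
Proof. by rewrite mem_filter mem_iota andbC. Qed.

Lemma indicesP P k : reflect ((k < n)%N /\ L k P) (k \in indices P).
Proof.
by rewrite mem_indices; apply: (iffP andP) => -[kn /asboolP kP].
Qed.

Lemma uniq_indices P : uniq (indices P).
Proof. exact/filter_uniq/iota_uniq. Qed.

(** Some line [L k] meets [L i] in a point off [L j], by [separated], so [L i] and [L j] cannot be
    the same set. *)
Lemma line_inj : {in `I_n &, injective L}.
Proof.
move=> i j; rewrite !inE => ilt jlt Lij; apply/eqP/contraT => ij.
have [k klt /andP[ik]] := separated ilt jlt ij.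
have [P [iP kP]] := meet_ex ilt klt ik.
by move/negP; case; apply/(concP ilt klt jlt ik iP kP); rewrite -Lij.
Qed.

Lemma card_lines : A #= `I_n.
Proof. exact: inj_card_eq line_inj. Qed.

Lemma card_lines_through P : lines_through A P #= `I_(size (indices P)).
Proof.
have -> : lines_through A P = L @` [set` indices P].
  apply/seteqP; split=> [_ [[i ilt <-] iP]|_ [i /= /indicesP[ilt iP] <-]].
    by exists i => //=; apply/indicesP.
  by split => //; exists i.
have sub i j : i \in [set` indices P] -> j \in [set` indices P] ->
    L i = L j -> i = j.
  rewrite !inE => /= /indicesP[ilt _] /indicesP[jlt _].
  by apply: line_inj; rewrite inE.
apply: (card_eq_trans (inj_card_eq sub)).
apply: (@card_eq_size _ _ _ id); [exact: uniq_indices | by [] | exact: image_id].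
Qed.

Lemma points_of_multP m P : points_of_mult A m P <-> size (indices P) = m.
Proof.
split=> [Pm|<-]; last exact: card_lines_through.
apply/card_eq_II.
exact: card_eq_trans (card_esym (card_lines_through P)) Pm.
Qed.

(** This is where geometry becomes computation: [P] lies on both lines, so by [concP] the boolean
    [conc i j] decides every incidence at [P]. *)
Lemma indices_flat i j P : i \in indices P -> j \in indices P -> i != j ->
  indices P = flat i j.
Proof.
move=> /indicesP[ilt iP] /indicesP[jlt jP] ij; apply: eq_in_filter => k.
rewrite mem_iota /= => klt; have kP := concP ilt jlt klt ij iP jP.
by apply/asboolP/idP => /kP.
Qed.

Lemma indices_gt1P P : (1 < size (indices P))%N <->
  exists i j, [/\ i \in indices P, j \in indices P & i != j].
Proof.
split=> [|[i [j [iP jP ij]]]].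
  move: (uniq_indices P); case: (indices P) => [|i [|j s]] //= /andP[].
  rewrite inE negb_or => /andP[ij _] _ _; exists i, j.
  by rewrite !inE !eqxx orbT.
rewrite ltnNge; apply/negP; move: iP jP.
case: (indices P) => [|k [|? ?]] //; rewrite !inE => /eqP ik /eqP jk _.
by rewrite ik jk eqxx in ij.
Qed.

Lemma flatsP s : s \in flats <->
  exists2 P, (1 < size (indices P))%N & indices P = s.
Proof.
rewrite mem_undup; split.
  move=> /allpairsPdep [i [j []]]; rewrite !mem_iota !add0n /= => ilt ji ->.
  have jlt := ltn_trans ji ilt; have ij : i != j by rewrite gtn_eqF.
  have [P [iP jP]] := meet_ex ilt jlt ij.
  have iI : i \in indices P by apply/indicesP.
  have jI : j \in indices P by apply/indicesP.
  exists P; last exact: indices_flat.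
  by apply/indices_gt1P; exists i, j.
move=> [P /indices_gt1P[i [j [iI jI ij]]] <-].
(* [flats] lists only the pairs with [j < i], so the two chosen lines are put in that order. *)
wlog ji : i j iI jI ij / (j < i)%N.
  move=> wl; move: (ij); rewrite neq_ltn => /orP[/wl|/wl]; apply=> //.
  by rewrite eq_sym.
apply/allpairsPdep; exists i, j; rewrite !mem_iota /= ji (indices_flat iI jI) //.
by split => //; case/indicesP: iI.
Qed.

(** On points of multiplicity at least 2, [indices] is injective: equal index lists share two
    distinct lines, which meet only once. The predicate [p] serves both the count by multiplicity
    and the count along a given line. *)
Lemma card_indices (p : pred (seq nat)) :
  [set P | (1 < size (indices P))%N /\ p (indices P)] #= `I_(count p flats).
Proof.
rewrite -size_filter; apply: (@card_eq_size _ _ _ indices).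
- exact/filter_uniq/undup_uniq.
- move=> P Q; rewrite !inE /= => -[/indices_gt1P[i [j [iP jP ij]]] _] _ PQ.
  have := iP; have := jP; rewrite {1 2}PQ.
  move: iP jP => /indicesP[ilt iP] /indicesP[jlt jP].
  by move=> /indicesP[_ jQ] /indicesP[_ iQ]; apply: (meet_uniq ilt jlt ij).
apply/seteqP; split=> [_ [P [P1 Pp] <-]|s]; rewrite /= mem_filter.
  by rewrite Pp; apply/flatsP; exists P.
by move=> /andP[ps /flatsP[P P1 Ps]]; exists P => //; split=> //; rewrite Ps.
Qed.

Lemma card_points_of_mult m : (1 < m)%N ->
  points_of_mult A m #= `I_(count (fun s => size s == m) flats).
Proof.
move=> m1; rewrite (_ : points_of_mult A m =
  [set P | (1 < size (indices P))%N /\ size (indices P) == m]).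
  exact: (card_indices (fun s => size s == m)).
apply/seteqP; split=> P; last by case=> _ /eqP /points_of_multP.
by move/points_of_multP => Pm; rewrite /= Pm.
Qed.

Lemma card_line_points_of_mult i m : (i < n)%N -> (1 < m)%N ->
  L i `&` points_of_mult A m
    #= `I_(count (fun s => (size s == m) && (i \in s)) flats).
Proof.
move=> ilt m1; rewrite (_ : _ `&` _ = [set P | (1 < size (indices P))%N /\
    (size (indices P) == m) && (i \in indices P)]).
  exact: (card_indices (fun s => (size s == m) && (i \in s))).
apply/seteqP; split=> P.
  move=> [iP /points_of_multP Pm]; split; rewrite Pm // eqxx /=.
  exact/indicesP.
by move=> [_ /andP[/eqP/points_of_multP Pm /indicesP[_ iP]]].
Qed.

Lemma intersection_pointsP P :
  intersection_points A P <-> (1 < size (indices P))%N.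
Proof.
split=> [[_ [_ [[[i ilt <-] iP] [[j jlt <-] jP] Lij]]]|].
  apply/indices_gt1P; exists i, j; split; try exact/indicesP.
  by apply/eqP => ij; rewrite ij in Lij.
move=> /indices_gt1P[i [j [/indicesP[ilt iP] /indicesP[jlt jP] /eqP ij]]].
exists (L i), (L j); split; [by split=> //; exists i | by split=> //; exists j |].
by move=> /line_inj; rewrite !inE => /(_ ilt jlt).
Qed.

End Incidence.

(** * Meeting points of projective lines as cross products *)

Section CrossProduct.

Variable K : fieldType.
Implicit Types (l m v : 'rV[K]_3) (P : proj_plane K).

Definition row3 (x y z : K) : 'rV[K]_3 := \row_i [:: x; y; z]`_i.

Definition dot l v : K := l 0 0 * v 0 0 + l 0 1 * v 0 1 + l 0 2 * v 0 2.

Definition cross l m : 'rV[K]_3 :=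
  row3 (l 0 1 * m 0 2 - l 0 2 * m 0 1)
       (l 0 2 * m 0 0 - l 0 0 * m 0 2)
       (l 0 0 * m 0 1 - l 0 1 * m 0 0).

Definition line l : set (proj_plane K) := line_eqn (l 0 0) (l 0 1) (l 0 2).

Lemma eq_row3 l m : l 0 0 = m 0 0 -> l 0 1 = m 0 1 -> l 0 2 = m 0 2 -> l = m.
Proof.
move=> e0 e1 e2; apply/rowP => -[[|[|[|//]]] lt3].
- by rewrite (_ : Ordinal _ = 0) //; apply: val_inj.
- by rewrite (_ : Ordinal _ = 1) //; apply: val_inj.
- by rewrite (_ : Ordinal _ = 2) //; apply: val_inj.
Qed.

Lemma point_ex v : v != 0 -> exists P, sval P = <[v]>%VS.
Proof.
move=> v0; have d : \dim <[v]> == 1%N by rewrite dim_vline v0.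
by exists (exist _ <[v]>%VS d).
Qed.

Lemma pointP P : exists2 v, v != 0 & sval P = <[v]>%VS.
Proof.
case: P => U /= /eqP dU; exists (vpick U).
  by rewrite vpick0 -dimv_eq0 dU.
apply/esym/eqP; rewrite eqEdim -memvE memv_pick dim_vline dU vpick0.
by rewrite -dimv_eq0 dU.
Qed.

Lemma lineP l v P : sval P = <[v]>%VS -> line l P <-> dot l v = 0.
Proof.
move=> PE; rewrite /line /line_eqn /= PE; split=> [|lv w /vlineP[c ->]].
  by apply; apply: memv_line.
rewrite !mxE; transitivity (c * dot l v); first by rewrite /dot; ring.
by rewrite lv mulr0.
Qed.

(* The identity (l x m) x v = (l . v) m - (m . v) l shows that v is parallel to
   l x m. *)
Lemma orthogonal_cross l m v : cross l m != 0 -> dot l v = 0 -> dot m v = 0 ->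
  exists c, v = c *: cross l m.
Proof.
move=> lm0 lv mv; set w := cross l m in lm0 *.
have w0 : w 0 0 = l 0 1 * m 0 2 - l 0 2 * m 0 1 by rewrite mxE.
have w1 : w 0 1 = l 0 2 * m 0 0 - l 0 0 * m 0 2 by rewrite mxE.
have w2 : w 0 2 = l 0 0 * m 0 1 - l 0 1 * m 0 0 by rewrite mxE.
have e01 : w 0 0 * v 0 1 = w 0 1 * v 0 0.
  transitivity (w 0 1 * v 0 0 + (dot l v * m 0 2 - dot m v * l 0 2)).
    by rewrite w0 w1 /dot; ring.
  by rewrite lv mv !mul0r subrr addr0.
have e02 : w 0 0 * v 0 2 = w 0 2 * v 0 0.
  transitivity (w 0 2 * v 0 0 + (dot m v * l 0 1 - dot l v * m 0 1)).
    by rewrite w0 w2 /dot; ring.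
  by rewrite lv mv !mul0r subrr addr0.
have e12 : w 0 1 * v 0 2 = w 0 2 * v 0 1.
  transitivity (w 0 2 * v 0 1 + (dot l v * m 0 0 - dot m v * l 0 0)).
    by rewrite w1 w2 /dot; ring.
  by rewrite lv mv !mul0r subrr addr0.
(* The factor is [v 0 i / w 0 i] for any coordinate with [w 0 i != 0]; one exists because [w] is
   nonzero. *)
have vE i j : w 0 i != 0 -> w 0 i * v 0 j = w 0 j * v 0 i ->
    v 0 j = (v 0 i / w 0 i *: w) 0 j.
  by move=> wi e; rewrite mxE; apply: (mulfI wi); rewrite e; field.
have [w00|w00] := eqVneq (w 0 0) 0; last first.
  by exists (v 0 0 / w 0 0); apply: eq_row3; apply: vE.
have [w01|w01] := eqVneq (w 0 1) 0; last first.
  by exists (v 0 1 / w 0 1); apply: eq_row3; apply: vE.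
have [w02|w02] := eqVneq (w 0 2) 0; last first.
  by exists (v 0 2 / w 0 2); apply: eq_row3; apply: vE.
by case/eqP: lm0; apply: eq_row3; rewrite [RHS]mxE.
Qed.

(** A spanning vector of [P] is a multiple of the cross product, and an inclusion between
    one-dimensional spaces is an equality. *)
Lemma meet_line l m P : cross l m != 0 -> line l P -> line m P ->
  sval P = <[cross l m]>%VS.
Proof.
move=> lm0; have [v v0 Pv] := pointP P.
move=> /(lineP _ Pv) lv /(lineP _ Pv) mv.
have [c vE] := orthogonal_cross lm0 lv mv.
rewrite Pv; apply/eqP; rewrite eqEdim -memvE !dim_vline v0 lm0 leqnn andbT.
by apply/vlineP; exists c.
Qed.

Lemma dot_crossl l m : dot l (cross l m) = 0.
Proof. by rewrite /dot !mxE /=; ring. Qed.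

Lemma dot_crossr l m : dot m (cross l m) = 0.
Proof. by rewrite /dot !mxE /=; ring. Qed.

Lemma is_line_line l : l != 0 -> is_line (line l).
Proof.
move=> l0; exists (l 0 0), (l 0 1), (l 0 2); split=> // -[e0 e1 e2].
by case/eqP: l0; apply: eq_row3; rewrite [RHS]mxE.
Qed.

End CrossProduct.

(** * Exact arithmetic in Z[a] and the finite checks on the twelve lines *)

(* The pair (u, v) stands for u + v a, where a^2 = - a - 2. *)
Definition quad := (int * int)%type.
Definition qadd (x y : quad) : quad := (x.1 + y.1, x.2 + y.2).
Definition qopp (x : quad) : quad := (- x.1, - x.2).
Definition qmul (x y : quad) : quad :=
  (x.1 * y.1 - 2 * x.2 * y.2, x.1 * y.2 + x.2 * y.1 - x.2 * y.2).

Definition qrow := (quad * quad * quad)%type.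
Definition qdot (l v : qrow) : quad :=
  qadd (qadd (qmul l.1.1 v.1.1) (qmul l.1.2 v.1.2)) (qmul l.2 v.2).
Definition qdet2 (x y z t : quad) : quad := qadd (qmul x t) (qopp (qmul y z)).
Definition qcross (l m : qrow) : qrow :=
  (qdet2 l.1.2 l.2 m.1.2 m.2, qdet2 l.2 l.1.1 m.2 m.1.1,
   qdet2 l.1.1 l.1.2 m.1.1 m.1.2).

(** The rows follow the order of the equations in [Kprime]; the default of [nth] is never reached
    for indices below 12. *)
Definition kprime_row (i : nat) : qrow :=
  let a := (0, 1) in let p := (1, 0) in let q := (-1, 0) in
  nth (p, p, p)
    [:: (a, p, q); (a, q, p); (a, q, q); (a, p, p);
        (p, a, q); (q, a, p); (q, a, q); (p, a, p);
        (q, p, a); (q, q, a); (p, q, a); (p, p, a)] i.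

Definition kprime_conc (i j k : nat) : bool :=
  qdot (kprime_row k) (qcross (kprime_row i) (kprime_row j)) == (0, 0).

Lemma kprime_qcross_neq0 i j : (i < 12)%N -> (j < 12)%N -> i != j ->
  qcross (kprime_row i) (kprime_row j) != ((0, 0), (0, 0), (0, 0)).
Proof.
have /allP all_neq0 : all (fun i => all (fun j => (i != j) ==>
    (qcross (kprime_row i) (kprime_row j) != ((0, 0), (0, 0), (0, 0))))
    (iota 0 12)) (iota 0 12) by vm_compute.
move=> ilt jlt; apply/implyP.
by apply: (allP (all_neq0 i _)); rewrite mem_iota.
Qed.

Lemma kprime_separated i j : (i < 12)%N -> (j < 12)%N -> i != j ->
  exists2 k, (k < 12)%N & (i != k) && ~~ kprime_conc i k j.
Proof.
have /allP all_sep : all (fun i => all (fun j => (i != j) ==>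
    has (fun k => (i != k) && ~~ kprime_conc i k j) (iota 0 12))
    (iota 0 12)) (iota 0 12) by vm_compute.
move=> ilt jlt ij; have /hasP[k] : has (fun k => (i != k) && ~~ kprime_conc i k j)
    (iota 0 12).
  by apply: (implyP (allP (all_sep i _) j _)); rewrite ?mem_iota.
by rewrite mem_iota => klt; exists k.
Qed.

(** Evaluating the finite list rules out points on four or more of the lines. *)
Lemma size_kprime_flats s : s \in flats 12 kprime_conc ->
  (size s == 3%N) || (size s == 2%N).
Proof.
have /allP all_size : all (fun s => (size s == 3%N) || (size s == 2%N))
  (flats 12 kprime_conc) by vm_compute.
exact: all_size.
Qed.

(** The two counts account for all pairs of lines: 12 triple points use 3 pairs each, 30 double
    points one each, and 36 + 30 = 66 is the number of pairs among 12 lines. *)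
Lemma count_kprime_flats3 :
  count (fun s => size s == 3%N) (flats 12 kprime_conc) = 12%N.
Proof. by vm_compute. Qed.

Lemma count_kprime_flats2 :
  count (fun s => size s == 2%N) (flats 12 kprime_conc) = 30%N.
Proof. by vm_compute. Qed.

Lemma count_kprime_line_flats3 i : (i < 12)%N ->
  count (fun s => (size s == 3%N) && (i \in s)) (flats 12 kprime_conc) = 3%N.
Proof.
have /allP all_count : all (fun i =>
    count (fun s => (size s == 3%N) && (i \in s)) (flats 12 kprime_conc) == 3%N)
  (iota 0 12) by vm_compute.
by move=> ilt; apply/eqP/all_count; rewrite mem_iota.
Qed.

(** * Evaluation of Z[a] in a field of characteristic zero, and the configuration *)

Section Evaluation.

Variables (K : numFieldType) (a : K).
Hypothesis a_root : a ^+ 2 + a + 2 = 0.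

Let sqr_a : a * a = - a - 2.
Proof. by apply/eqP; rewrite -subr_eq0 -[X in _ == X]a_root; apply/eqP; ring. Qed.

Definition qeval (x : quad) : K := x.1%:~R + x.2%:~R * a.

Lemma qevalD x y : qeval (qadd x y) = qeval x + qeval y.
Proof. by rewrite /qeval /= !intrD; ring. Qed.

Lemma qevalN x : qeval (qopp x) = - qeval x.
Proof. by rewrite /qeval /= !mulrNz; ring. Qed.

Lemma qevalM x y : qeval (qmul x y) = qeval x * qeval y.
Proof.
by rewrite /qeval /= !(rmorphB, rmorphD, rmorphM) /=; ring: sqr_a.
Qed.

Lemma qeval_eq0 x : (qeval x == 0) = (x == (0, 0)).
Proof.
apply/eqP/eqP => [|->]; last by rewrite /qeval mul0r addr0.
case: x => u v; rewrite /qeval /= => x0.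
have : (u ^+ 2 - u * v + 2 * v ^+ 2)%:~R = 0 :> K.
  rewrite !(rmorphB, rmorphD, rmorphM, rmorphXn) /=.
  (* The other root of x^2 + x + 2 is -1 - a, so the second factor is the conjugate of u + v a and
     the product is its norm. *)
  transitivity ((u%:~R + v%:~R * a) * (u%:~R - v%:~R - v%:~R * a)).
    by ring: sqr_a.
  by rewrite x0 mul0r.
move=> /eqP; rewrite intr_eq0 => /eqP norm0.
(* The norm form is positive definite: 4 (u^2 - u v + 2 v^2) = (2 u - v)^2 + 7 v^2. *)
have v0 : v = 0 by apply/eqP; rewrite -sqrf_eq0; apply/eqP; nra.
have u0 : u = 0 by apply/eqP; rewrite -sqrf_eq0; apply/eqP; nra.
by rewrite u0 v0.
Qed.

Definition qeval_row (l : qrow) : 'rV[K]_3 :=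
  row3 (qeval l.1.1) (qeval l.1.2) (qeval l.2).

Lemma qeval_cross l m :
  qeval_row (qcross l m) = cross (qeval_row l) (qeval_row m).
Proof. by apply: eq_row3; rewrite !mxE /= !(qevalD, qevalN, qevalM). Qed.

Lemma qeval_dot l v : qeval (qdot l v) = dot (qeval_row l) (qeval_row v).
Proof. by rewrite /dot !mxE /= !(qevalD, qevalM). Qed.

Lemma qeval_row_neq0 l : l != ((0, 0), (0, 0), (0, 0)) -> qeval_row l != 0.
Proof.
apply: contra => /eqP l0; case: l l0 => -[x y] z l0; apply/eqP.
have [x0 y0 z0] : [/\ qeval x == 0, qeval y == 0 & qeval z == 0].
  by split; apply/eqP; [have /rowP/(_ 0) := l0 | have /rowP/(_ 1) := l0 |
    have /rowP/(_ 2) := l0]; rewrite !mxE.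
by move: x0 y0 z0; rewrite !qeval_eq0 => /eqP-> /eqP-> /eqP->.
Qed.

Definition kprime_line (i : nat) : set (proj_plane K) :=
  line (qeval_row (kprime_row i)).

Lemma KprimeE : Kprime a = kprime_line @` `I_12.
Proof.
have lineE x y z : line (qeval_row (x, y, z)) =
    line_eqn (qeval x) (qeval y) (qeval z).
  by rewrite /line !mxE.
have ea : qeval (0, 1) = a by rewrite /qeval mul1r add0r.
have e1 : qeval (1, 0) = 1 by rewrite /qeval mul0r addr0.
have eN1 : qeval (-1, 0) = -1 by rewrite /qeval mul0r addr0.
apply/seteqP; split=> [M|_ [i ilt <-]].
  move=> [[[[[[[[[[[]|]|]|]|]|]|]|]|]|]|] ->;
  [exists 0%N | exists 1%N | exists 2%N | exists 3%N | exists 4%N | exists 5%N |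
   exists 6%N | exists 7%N | exists 8%N | exists 9%N | exists 10%N | exists 11%N];
  by rewrite // /kprime_line lineE !(ea, e1, eN1).
move: ilt; do 12?[case: i => [_|i]] => //;
  rewrite /kprime_line lineE !(ea, e1, eN1) /Kprime /=; tauto.
Qed.

Lemma kprime_cross_neq0 i j : (i < 12)%N -> (j < 12)%N -> i != j ->
  cross (qeval_row (kprime_row i)) (qeval_row (kprime_row j)) != 0.
Proof.
by move=> ilt jlt ij; rewrite -qeval_cross qeval_row_neq0 ?kprime_qcross_neq0.
Qed.

Lemma kprime_meet_ex i j : (i < 12)%N -> (j < 12)%N -> i != j ->
  exists P, kprime_line i P /\ kprime_line j P.
Proof.
move=> ilt jlt ij; have [P PE] := point_ex (kprime_cross_neq0 ilt jlt ij).
by exists P; split; apply/(lineP _ PE); rewrite (dot_crossl, dot_crossr).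
Qed.

Lemma kprime_meet_uniq i j P Q : (i < 12)%N -> (j < 12)%N -> i != j ->
  kprime_line i P -> kprime_line j P -> kprime_line i Q -> kprime_line j Q ->
  P = Q.
Proof.
move=> ilt jlt ij iP jP iQ jQ; have c0 := kprime_cross_neq0 ilt jlt ij.
apply: val_inj; rewrite /= (meet_line c0 iP jP).
by rewrite (meet_line c0 iQ jQ).
Qed.

Lemma kprime_concP i j k P :
  (i < 12)%N -> (j < 12)%N -> (k < 12)%N -> i != j ->
  kprime_line i P -> kprime_line j P -> kprime_line k P <-> kprime_conc i j k.
Proof.
move=> ilt jlt _ ij iP jP; have c0 := kprime_cross_neq0 ilt jlt ij.
rewrite /kprime_conc -qeval_eq0 qeval_dot qeval_cross -(rwP eqP).
(* [P] is spanned by the cross product of rows i and j, so incidence with line k is the vanishing of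
   a single dot product. *)
exact: lineP _ (meet_line c0 iP jP).
Qed.

Lemma kprime_is_line L : Kprime a L -> is_line L.
Proof.
rewrite KprimeE => -[i ilt <-]; apply: is_line_line; apply: qeval_row_neq0.
by move: ilt; do 12?[case: i => [_|i]].
Qed.

Lemma kprime_configuration :
  [/\ intersection_points (Kprime a) =
        triple_points (Kprime a) `|` double_points (Kprime a),
      triple_points (Kprime a) #= `I_12,
      double_points (Kprime a) #= `I_30,
      forall L, Kprime a L -> (L `&` triple_points (Kprime a)) #= `I_3 &
      is_configuration 12 3 (triple_points (Kprime a)) (Kprime a)].
Proof.
have mult := points_of_multP kprime_meet_ex kprime_concP kprime_separated.
have inter := intersection_pointsP kprime_meet_ex kprime_concP kprime_separated.
have card_mult := card_points_of_mult kprime_meet_ex kprime_meet_uniq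
  kprime_concP kprime_separated.
have card_line := card_line_points_of_mult kprime_meet_ex kprime_meet_uniq
  kprime_concP kprime_separated.
have card3 : triple_points (Kprime a) #= `I_12.
  by rewrite -count_kprime_flats3 KprimeE; apply: card_mult.
have line3 L : Kprime a L -> (L `&` triple_points (Kprime a)) #= `I_3.
  rewrite KprimeE => -[i ilt <-]; have := card_line i 3%N ilt isT.
  by rewrite count_kprime_line_flats3.
split=> //.
- rewrite KprimeE; apply/seteqP; split=> P; last first.
    by case=> /mult Pm; apply/inter; rewrite Pm.
  move=> /inter P1.
  (* The index list of an intersection point is one of the computed flats, so its length is 3 or
     2. *)
  have Pf : indices 12 kprime_line P \in flats 12 kprime_conc.
    by apply/(flatsP kprime_meet_ex kprime_concP); exists P.
  case/orP: (size_kprime_flats Pf) => /eqP Pm; [left|right]; exact/mult.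
- by rewrite -count_kprime_flats2 KprimeE; apply: card_mult.
(* That three lines pass through each triple point is the definition of [triple_points]; what
   remains is that the twelve lines are distinct and are indeed lines. *)
- split=> //; last exact: kprime_is_line.
  rewrite KprimeE.
  exact: card_lines kprime_meet_ex kprime_concP kprime_separated.
Qed.

End Evaluation.

Theorem proposition2p1 (R : realType) (a : R[i]) (ha : root ('X^2 + 'X + 2%:P) a) :
  [/\ intersection_points (Kprime a) =
        triple_points (Kprime a) `|` double_points (Kprime a),
      triple_points (Kprime a) #= `I_12,
      double_points (Kprime a) #= `I_30,
      forall L, Kprime a L -> (L `&` triple_points (Kprime a)) #= `I_3 &
      is_configuration 12 3 (triple_points (Kprime a)) (Kprime a)].
Proof.
apply: kprime_configuration; move/rootP: ha.
by rewrite !hornerE.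
Qed.
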